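(* Let $A$ and $A+\Delta A$ be real $m\times n$ matrices with $\mathrm{rank}(A)=n$ and $\|\Delta A\|_2\|A^\dagger\|_2\le 1/2$. Let $\ell_j$, $1\le j\le m$, be the leverage scores of $A$, and let $\tilde{\ell}_j$, $1\le j\le m$, be the leverage scores of $A+\Delta A$ computed (in exact arithmetic) from a QR decomposition of $A+\Delta A$. Let $$\epsilon_F^{\perp}=\frac{\|(I_m-AA^\dagger)\,\Delta A\|_F}{\|A\|_F},\qquad \epsilon_j^{\perp}=\frac{\|e_j^T(I_m-AA^\dagger)\,\Delta A\|_2}{\|e_j^TA\|_2}.$$ Then for every $1\le j\le m$ with $\ell_j>0$, $$\frac{|\tilde{\ell}_j-\ell_j|}{\ell_j}\le 4\left(\epsilon_j^{\perp}+\sqrt{2}\,\mathrm{sr}(A)^{1/2}\,\epsilon_F^{\perp}\right)\kappa_2(A)+\mathcal{O}\left((\epsilon_F^{\perp})^2\right).$$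
   Context: Leverage scores: if $A$ is a real $m\times n$ matrix with $\mathrm{rank}(A)=n$ and $Q$ is any $m\times n$ matrix whose columns form an orthonormal basis of $\mathrm{range}(A)$, the leverage scores of $A$ are $\ell_j=\|e_j^TQ\|_2^2$, $1\le j\le m$, where $e_j$ is the $j$th column of the $m\times m$ identity $I_m$ (this is independent of the choice of $Q$). The leverage scores computed from a thin QR decomposition $A+\Delta A=\tilde{Q}\tilde{R}$ ($\tilde{Q}$ being $m\times n$ with orthonormal columns, $\tilde{R}$ being $n\times n$ upper triangular and nonsingular) are $\tilde{\ell}_j=\|e_j^T\tilde{Q}\|_2^2$; exact arithmetic is assumed. $\|\cdot\|_2$ is the spectral norm of a matrix (Euclidean norm of a row vector), $\|\cdot\|_F$ the Frobenius norm, $A^\dagger$ the Moore-Penrose inverse, $\kappa_2(A)=\|A\|_2\|A^\dagger\|_2$, and $\mathrm{sr}(A)=\|A\|_F^2/\|A\|_2^2$ is the stable rank. The hypothesis implies $\mathrm{rank}(A+\Delta A)=n$; $\ell_j>0$ implies $e_j^TA\ne0$. The symbol $\mathcal{O}((\epsilon_F^{\perp})^2)$ is understood for fixed $A$ as $\epsilon_F^{\perp}\to0$: it is a term bounded by $C(\epsilon_F^{\perp})^2$ for all admissible $\Delta A$ with $\epsilon_F^{\perp}$ sufficiently small, where $C$ and the smallness threshold depend only on $A$. *)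

(* Defs.v *)
From mathcomp Require Import all_boot all_order all_algebra.
From mathcomp Require Import boolp classical_sets reals.

Set Implicit Arguments.
Unset Strict Implicit.
Unset Printing Implicit Defensive.

Import Order.TTheory GRing.Theory Num.Theory.

Local Open Scope classical_set_scope.
Local Open Scope ring_scope.

Definition l2norm (R : realType) (n : nat) (v : 'rV[R]_n) : R :=
  Num.sqrt (\sum_j v 0 j ^+ 2).

Definition frobnorm (R : realType) (m n : nat) (A : 'M[R]_(m, n)) : R :=
  Num.sqrt (\sum_i \sum_j A i j ^+ 2).

(* The unit ball, rather than the unit sphere, keeps the set nonempty
   when n = 0. *)
Definition specnorm (R : realType) (m n : nat) (A : 'M[R]_(m, n)) : R :=
  sup [set l2norm (A *m x)^T | x in [set x : 'cV[R]_n | l2norm x^T <= 1]].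

Definition penrose (R : realType) (m n : nat)
    (A : 'M[R]_(m, n)) (X : 'M[R]_(n, m)) : Prop :=
  [/\ A *m X *m A = A,
      X *m A *m X = X,
      (A *m X)^T = A *m X
    & (X *m A)^T = X *m A].

(* The default value 0 is never reached, see mpinvP. *)
Definition mpinv (R : realType) (m n : nat) (A : 'M[R]_(m, n)) : 'M[R]_(n, m) :=
  xget 0 [set X | penrose A X].

Lemma mul_mx_tr_unit (R : realType) (r n : nat) (B : 'M[R]_(r, n)) :
  row_free B -> B *m B^T \in unitmx.
Proof.
move=> fB; rewrite -row_free_unit -kermx_eq0.
apply/rowV0P => u /sub_kermxP uBB0.
have uB0 : u *m B = 0.
  have : ((u *m B) *m (u *m B)^T) 0 0 = 0.
    by rewrite trmx_mul mulmxA -(mulmxA u) uBB0 mul0mx mxE.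
  rewrite mxE => /eqP; rewrite psumr_eq0; last first.
    by move=> j _; rewrite [_^T _ _]mxE -expr2 sqr_ge0.
  move/allP => h; apply/rowP => j; rewrite [RHS]mxE.
  by have := h j (mem_index_enum j); rewrite /= [_^T _ _]mxE -expr2 sqrf_eq0 => /eqP.
by apply: (row_free_inj fB); rewrite uB0 mul0mx.
Qed.

Lemma penrose_exists (R : realType) (m n : nat) (A : 'M[R]_(m, n)) :
  exists X, penrose A X.
Proof.
have := mulmx_base A; have := row_base_free A; have := col_base_full A.
move: (\rank A) (col_base A) (row_base A) => r C F fC fF /esym AE.
have uF : F *m F^T \in unitmx by exact: mul_mx_tr_unit.
have uC : C^T *m C \in unitmx.
  by rewrite -{2}(trmxK C); apply: mul_mx_tr_unit; rewrite /row_free mxrank_tr.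
pose X := F^T *m invmx (F *m F^T) *m invmx (C^T *m C) *m C^T.
have AX : A *m X = C *m invmx (C^T *m C) *m C^T.
  by rewrite AE /X !mulmxA -(mulmxA C F) mulmxK.
have XA : X *m A = F^T *m invmx (F *m F^T) *m F.
  by rewrite AE /X -!mulmxA (mulmxA C^T) (mulmxA (invmx (C^T *m C))) mulVmx // mul1mx.
exists X; split.
- by rewrite AX AE -!mulmxA (mulmxA C^T) (mulmxA (invmx (C^T *m C))) mulVmx // mul1mx.
- rewrite XA /X !mulmxA -(mulmxA _ F F^T).
  by rewrite -(mulmxA F^T (invmx (F *m F^T)) (F *m F^T)) mulVmx // mulmx1.
- by rewrite AX !trmx_mul trmxK trmx_inv trmx_mul trmxK mulmxA.
- by rewrite XA !trmx_mul trmxK trmx_inv trmx_mul trmxK mulmxA.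
Qed.

Lemma penrose_unique (R : realType) (m n : nat) (A : 'M[R]_(m, n))
    (X Y : 'M[R]_(n, m)) :
  penrose A X -> penrose A Y -> X = Y.
Proof.
move=> [x1 x2 x3 x4] [y1 y2 y3 y4].
have eAX : A *m X = A *m Y.
  rewrite -x3 -{1}y1 -(mulmxA (A *m Y)) trmx_mul x3 y3.
  by rewrite mulmxA x1.
have eXA : X *m A = Y *m A.
  rewrite -x4 -{1}y1 -(mulmxA A Y A) mulmxA trmx_mul x4 y4.
  by rewrite -(mulmxA Y A) (mulmxA A X) x1.
by rewrite -x2 eXA -mulmxA eAX mulmxA y2.
Qed.

Lemma mpinvP (R : realType) (m n : nat) (A : 'M[R]_(m, n)) :
  penrose A (mpinv A).
Proof. exact: (xgetPex 0 (penrose_exists A)). Qed.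

Definition cond2 (R : realType) (m n : nat) (A : 'M[R]_(m, n)) : R :=
  specnorm A * specnorm (mpinv A).

Definition stable_rank (R : realType) (m n : nat) (A : 'M[R]_(m, n)) : R :=
  frobnorm A ^+ 2 / specnorm A ^+ 2.

(* range A is the column space of A, i.e. the row space of A^T. *)
Definition orthonormal_basis_of_range (R : realType) (m n : nat)
    (A Q : 'M[R]_(m, n)) : Prop :=
  Q^T *m Q = 1%:M /\ (Q^T == A^T)%MS.

(* is_trig_mx means lower triangular, hence the transpose. *)
Definition thin_qr (R : realType) (m n : nat)
    (B Q : 'M[R]_(m, n)) (T : 'M[R]_n) : Prop :=
  [/\ B = Q *m T, Q^T *m Q = 1%:M, is_trig_mx T^T & T \in unitmx].

Definition leverage (R : realType) (m n : nat) (Q : 'M[R]_(m, n)) (j : 'I_m) : R :=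
  l2norm (row j Q) ^+ 2.

Definition perp_part (R : realType) (m n : nat) (A dA : 'M[R]_(m, n)) :
    'M[R]_(m, n) :=
  (1%:M - A *m mpinv A) *m dA.

Definition epsF (R : realType) (m n : nat) (A dA : 'M[R]_(m, n)) : R :=
  frobnorm (perp_part A dA) / frobnorm A.

Definition epsj (R : realType) (m n : nat) (A dA : 'M[R]_(m, n)) (j : 'I_m) : R :=
  l2norm (row j (perp_part A dA)) / l2norm (row j A).

(* Main.v *)
Require Import Defs.
From mathcomp Require Import all_boot all_order all_algebra.
From mathcomp Require Import boolp classical_sets reals.
From mathcomp Require Import ring lra.

Import Order.TTheory GRing.Theory Num.Theory.
Local Open Scope ring_scope.

(** Write [A = Q T] with [T] invertible and [X] for the pseudoinverse, so that
    [P = A X = Q Q^T]. Since [M = 1 + X dA] is invertible with [|M^-1| <= 2], the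
    splitting [A + dA = A M + (1 - P) dA] shows that [A + dA] has the same range as
    [Q + F], where [F = (1 - P) dA M^-1 T^-1] satisfies [Q^T F = 0]. The projector
    onto that range is therefore [(Q + F) (1 + F^T F)^-1 (Q + F)^T], and
    [1 - F^T F <= (1 + F^T F)^-1 <= 1] bounds the change of its [j]-th diagonal
    entry by [2 |q| |f|] up to terms quadratic in [F], where [q] and [f] are the
    [j]-th rows of [Q] and [F]. Finally [|f| <= 2 |X| |e_j (1 - P) dA|] and
    [|e_j A| <= |A| |q|]; the first-order term is thus at most [4 epsj cond2]. *)

(** * Euclidean norm of row vectors and the Cauchy-Schwarz inequality *)

Section EuclideanNorm.
Set Implicit Arguments.
Unset Strict Implicit.
Context {R : realType}.

Lemma mul_tr_entry (n : nat) (u v : 'rV[R]_n) :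
  (u *m v^T) 0 0 = \sum_j u 0 j * v 0 j.
Proof. by rewrite mxE; apply: eq_bigr => j _; rewrite mxE. Qed.

Lemma l2norm_ge0 (n : nat) (v : 'rV[R]_n) : 0 <= l2norm v.
Proof. exact: sqrtr_ge0. Qed.

Lemma sqr_l2normE (n : nat) (v : 'rV[R]_n) :
  l2norm v ^+ 2 = \sum_j v 0 j ^+ 2.
Proof. by rewrite sqr_sqrtr // sumr_ge0 // => j _; exact: sqr_ge0. Qed.

Lemma sqr_l2norm (n : nat) (v : 'rV[R]_n) : l2norm v ^+ 2 = (v *m v^T) 0 0.
Proof.
by rewrite sqr_l2normE mul_tr_entry; apply: eq_bigr => j _; rewrite expr2.
Qed.

Lemma l2norm0 (n : nat) : l2norm (0 : 'rV[R]_n) = 0.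
Proof.
rewrite /l2norm big1 ?sqrtr0 // => j _.
by rewrite mxE expr0n.
Qed.

Lemma l2norm_eq0 (n : nat) (v : 'rV[R]_n) : l2norm v = 0 -> v = 0.
Proof.
move=> v0; have : \sum_j v 0 j ^+ 2 = 0 by rewrite -sqr_l2normE v0 expr0n.
move/eqP; rewrite psumr_eq0; last by move=> j _; exact: sqr_ge0.
move/allP => h; apply/rowP => j; rewrite [RHS]mxE.
by have := h j (mem_index_enum j); rewrite /= sqrf_eq0 => /eqP.
Qed.

Lemma sqr_l2normD (n : nat) (u v : 'rV[R]_n) :
  l2norm (u + v) ^+ 2 = l2norm u ^+ 2 + 2 * (u *m v^T) 0 0 + l2norm v ^+ 2.
Proof.
rewrite !sqr_l2normE mul_tr_entry mulr_sumr -!big_split /=.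
by apply: eq_bigr => j _; rewrite mxE; ring.
Qed.

Lemma l2normZ (n : nat) (a : R) (u : 'rV[R]_n) :
  l2norm (a *: u) = `|a| * l2norm u.
Proof.
rewrite /l2norm -sqrtr_sqr -sqrtrM ?sqr_ge0 // mulr_sumr.
by congr Num.sqrt; apply: eq_bigr => j _; rewrite mxE exprMn.
Qed.

Lemma l2normN (n : nat) (u : 'rV[R]_n) : l2norm (- u) = l2norm u.
Proof. by rewrite -scaleN1r l2normZ normrN1 mul1r. Qed.

(** With [c] the inner product, the squared norm of [|v|^2 u - c v] is nonnegative and factors as
    [|v|^2 (|u|^2 |v|^2 - c^2)]; for nonzero [v] the first factor cancels. *)
Lemma cauchy_schwarz (n : nat) (u v : 'rV[R]_n) :
  `|(u *m v^T) 0 0| <= l2norm u * l2norm v.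
Proof.
have [v0|v0] := eqVneq (l2norm v) 0.
  by rewrite v0 (l2norm_eq0 v0) trmx0 mulmx0 mxE normr0 mulr0.
have vp : 0 < l2norm v by rewrite lt_neqAle eq_sym v0 l2norm_ge0.
rewrite -ler_sqr ?nnegrE ?mulr_ge0 ?l2norm_ge0 // real_normK ?num_real //.
set c := (u *m v^T) 0 0.
have := sqr_ge0 (l2norm (l2norm v ^+ 2 *: u + - c *: v)).
rewrite sqr_l2normD !l2normZ !exprMn !real_normK ?num_real //.
rewrite linearZ /= -scalemxAr -scalemxAl scalerA mxE -/c.
move=> h; have : 0 <= l2norm v ^+ 2 * ((l2norm u * l2norm v) ^+ 2 - c ^+ 2).
  by apply: (le_trans h); rewrite le_eqVlt; apply/orP; left; apply/eqP; ring.
by rewrite pmulr_rge0 ?exprn_gt0 // subr_ge0 exprMn.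
Qed.

Lemma l2normD (n : nat) (u v : 'rV[R]_n) :
  l2norm (u + v) <= l2norm u + l2norm v.
Proof.
rewrite -ler_sqr ?nnegrE ?addr_ge0 ?l2norm_ge0 //.
rewrite sqr_l2normD; have := cauchy_schwarz u v; rewrite ler_norml.
by move=> /andP[_ h]; nra.
Qed.

Lemma l2norm_mul_isometry (m n : nat) (v : 'rV[R]_n) (Q : 'M[R]_(m, n)) :
  Q^T *m Q = 1%:M -> l2norm (v *m Q^T) = l2norm v.
Proof.
move=> QQ; apply/eqP; rewrite -(@eqrXn2 _ 2) ?l2norm_ge0 //; apply/eqP.
by rewrite !sqr_l2norm trmx_mul trmxK mulmxA -(mulmxA v) QQ mulmx1.
Qed.

End EuclideanNorm.

(** * Frobenius and spectral norms as bounds for matrix-vector products *)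

Section MatrixNorms.
Set Implicit Arguments.
Unset Strict Implicit.
Context {R : realType}.

Lemma frobnorm_ge0 (m n : nat) (A : 'M[R]_(m, n)) : 0 <= frobnorm A.
Proof. exact: sqrtr_ge0. Qed.

Lemma sqr_frobnorm (m n : nat) (A : 'M[R]_(m, n)) :
  frobnorm A ^+ 2 = \sum_i l2norm (row i A) ^+ 2.
Proof.
rewrite sqr_sqrtr; last first.
  by do 2!(apply: sumr_ge0 => ? _); exact: sqr_ge0.
apply: eq_bigr => i _; rewrite sqr_l2normE.
by apply: eq_bigr => j _; rewrite mxE.
Qed.

Lemma l2norm_row_le_frobnorm (m n : nat) (A : 'M[R]_(m, n)) (i : 'I_m) :
  l2norm (row i A) <= frobnorm A.
Proof.
rewrite -ler_sqr ?nnegrE ?l2norm_ge0 ?frobnorm_ge0 // sqr_frobnorm (bigD1 i) //=.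
by rewrite lerDl sumr_ge0 // => k _; exact: sqr_ge0.
Qed.

Lemma frobnorm_le_rows (m n p : nat) (A : 'M[R]_(m, n)) (B : 'M[R]_(m, p)) (c : R) :
  0 <= c -> (forall i, l2norm (row i A) <= c * l2norm (row i B)) ->
  frobnorm A <= c * frobnorm B.
Proof.
move=> c0 h; rewrite -ler_sqr ?nnegrE ?mulr_ge0 ?frobnorm_ge0 //.
rewrite exprMn !sqr_frobnorm mulr_sumr; apply: ler_sum => i _.
by rewrite -exprMn ler_sqr ?nnegrE ?mulr_ge0 ?l2norm_ge0.
Qed.

Lemma l2norm_mul_frobnorm (m n : nat) (A : 'M[R]_(m, n)) (v : 'rV[R]_n) :
  l2norm (v *m A^T) <= frobnorm A * l2norm v.
Proof.
rewrite -ler_sqr ?nnegrE ?mulr_ge0 ?l2norm_ge0 ?frobnorm_ge0 //.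
rewrite exprMn sqr_l2normE sqr_frobnorm mulr_suml; apply: ler_sum => i _.
have -> : (v *m A^T) 0 i = (v *m (row i A)^T) 0 0.
  by rewrite mul_tr_entry mxE; apply: eq_bigr => k _; rewrite !mxE.
rewrite -exprMn -real_normK ?num_real //.
by rewrite ler_sqr ?nnegrE ?mulr_ge0 ?l2norm_ge0 // mulrC cauchy_schwarz.
Qed.

(** A supremum is an upper bound only for a set that is bounded above; the Frobenius norm provides
    the bound. *)
Lemma specnorm_ub (m n : nat) (A : 'M[R]_(m, n)) (x : 'cV[R]_n) :
  l2norm x^T <= 1 -> l2norm (A *m x)^T <= specnorm A.
Proof.
move=> x1; apply: ub_le_sup; last by exists x.
exists (frobnorm A) => _ [y /= y1 <-]; rewrite trmx_mul.
apply: (le_trans (l2norm_mul_frobnorm _ _)).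
by rewrite -[leRHS]mulr1 ler_wpM2l ?frobnorm_ge0.
Qed.

Lemma specnorm_ge0 (m n : nat) (A : 'M[R]_(m, n)) : 0 <= specnorm A.
Proof.
apply: (le_trans (l2norm_ge0 (A *m 0)^T)).
by apply: specnorm_ub; rewrite trmx0 l2norm0 ler01.
Qed.

Lemma l2norm_mulmxl (m n : nat) (A : 'M[R]_(m, n)) (x : 'cV[R]_n) :
  l2norm (A *m x)^T <= specnorm A * l2norm x^T.
Proof.
have [x0|x0] := eqVneq (l2norm x^T) 0.
  have /eqP := l2norm_eq0 x0; rewrite trmx_eq0 => /eqP ->.
  by rewrite mulmx0 !trmx0 !l2norm0 mulr0.
have xp : 0 < l2norm x^T by rewrite lt_neqAle eq_sym x0 l2norm_ge0.
have := @specnorm_ub _ _ A ((l2norm x^T)^-1 *: x).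
rewrite -scalemxAr !linearZ /= !l2normZ ger0_norm ?invr_ge0 ?l2norm_ge0 //.
by rewrite mulVf // lexx mulrC ler_pdivrMr // => /(_ isT).
Qed.

(* [|v A|^2 = v (A (v A)^T)], which avoids the norm of the transpose. *)
Lemma l2norm_mulmxr (m n : nat) (A : 'M[R]_(m, n)) (v : 'rV[R]_m) :
  l2norm (v *m A) <= specnorm A * l2norm v.
Proof.
have [w0|w0] := eqVneq (l2norm (v *m A)) 0.
  by rewrite w0 mulr_ge0 ?specnorm_ge0 ?l2norm_ge0.
have wp : 0 < l2norm (v *m A) by rewrite lt_neqAle eq_sym w0 l2norm_ge0.
rewrite -(ler_pM2r wp) -expr2 sqr_l2norm -mulmxA.
rewrite -[A *m _]trmxK; apply: (le_trans (ler_norm _)).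
apply: (le_trans (cauchy_schwarz _ _)).
rewrite mulrAC [leRHS]mulrC ler_wpM2l ?l2norm_ge0 //.
by have := l2norm_mulmxl A (v *m A)^T; rewrite trmxK.
Qed.

End MatrixNorms.

(** * Perturbation of the range and of the diagonal of its projector *)

Section Perturbation.
Set Implicit Arguments.
Unset Strict Implicit.
Context {R : realType}.

(** This is [1 - G <= W <= 1] as quadratic forms, where [G = F^T F] and [W = (1 + G)^-1]. *)
Lemma inv_gram_bounds (m n : nat) (F : 'M[R]_(m, n)) (W : 'M[R]_n) (w : 'rV[R]_n) :
  W^T = W -> W *m (1%:M + F^T *m F) = 1%:M ->
  (forall v : 'rV[R]_n, 0 <= (v *m W *m v^T) 0 0) ->
  l2norm w ^+ 2 - l2norm (w *m F^T) ^+ 2 <= (w *m W *m w^T) 0 0 <= l2norm w ^+ 2.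
Proof.
move=> sW WG Wge0; apply/andP; split.
  have GW : (1%:M + F^T *m F) *m W = 1%:M by apply: mulmx1C.
  set G := F^T *m F in WG GW.
  (* Substituting [W = 1 - G W] into [W = 1 - W G] isolates the remainder [G W G], whose quadratic
     form at [w] is that of [W] at [w G], hence nonnegative. *)
  have WE : W = 1%:M - G + G *m W *m G.
    have W1 : W = 1%:M - W *m G by rewrite -WG mulmxDr mulmx1 addrK.
    have W2 : W = 1%:M - G *m W by rewrite -GW mulmxDl mul1mx addrK.
    by rewrite {1}W1 {1}W2 mulmxBl mul1mx opprB addrA addrAC.
  have -> : w *m W *m w^T
      = w *m w^T - w *m F^T *m (w *m F^T)^T + w *m G *m W *m (w *m G)^T.
    rewrite [in LHS]WE !trmx_mul !trmxK !mulmxDr !mulmxDl mulmxN mulNmx mulmx1.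
    by rewrite /G !mulmxA.
  rewrite !sqr_l2norm ![fun_of_matrix (_ + _) _ _]mxE ![fun_of_matrix (- _) _ _]mxE lerDl.
  exact: Wge0.
(* For the upper bound, writing [W = W (1 + G) W] shows that the form dominates [|w W|^2]. It is
   also at most [|w W| |w| <= (|w W|^2 + |w|^2) / 2], and absorbing the first term on the left gives
   [|w|^2]. *)
have e : (w *m W *m w^T) 0 0 = l2norm (w *m W) ^+ 2 + l2norm (w *m W *m F^T) ^+ 2.
  rewrite !sqr_l2norm !trmx_mul trmxK sW.
  have -> : w *m W *m w^T = w *m W *m (1%:M + F^T *m F) *m W *m w^T.
    by rewrite -(mulmxA w W (_ + _)) WG mulmx1.
  by rewrite mulmxDr mulmx1 !mulmxDl ![fun_of_matrix (_ + _) _ _]mxE !mulmxA.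
have := cauchy_schwarz (w *m W) w; rewrite ler_norml => /andP[_].
have := sqr_ge0 (l2norm w - l2norm (w *m W)).
have := sqr_ge0 (l2norm (w *m W *m F^T)).
by rewrite e; nra.
Qed.

(** The cross terms vanish, so the Gram matrix of [Q + F] is [1 + F^T F]. Orthonormality of [Qt]
    then forces [S S^T] to be its inverse, and [inv_gram_bounds] applies with [W = S S^T]. *)
Lemma leverage_graph_bounds (m n : nat) (Q F Qt : 'M[R]_(m, n)) (S : 'M[R]_n)
    (j : 'I_m) :
  Q^T *m Q = 1%:M -> Q^T *m F = 0 -> Qt = (Q + F) *m S -> Qt^T *m Qt = 1%:M ->
  l2norm (row j (Q + F)) ^+ 2 - l2norm (row j (Q + F) *m F^T) ^+ 2
    <= leverage Qt j <= l2norm (row j (Q + F)) ^+ 2.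
Proof.
move=> QQ QF QtE QtQt.
have FQ : F^T *m Q = 0 by rewrite -[LHS]trmxK trmx_mul trmxK QF trmx0.
have QFQF : (Q + F)^T *m (Q + F) = 1%:M + F^T *m F.
  by rewrite [(Q + F)^T]linearD /= mulmxDl !mulmxDr QQ QF FQ addr0 add0r.
have SGS : S^T *m ((1%:M + F^T *m F) *m S) = 1%:M.
  by rewrite -[RHS]QtQt QtE trmx_mul -QFQF !mulmxA.
have -> : leverage Qt j = (row j (Q + F) *m (S *m S^T) *m (row j (Q + F))^T) 0 0.
  by rewrite /leverage QtE row_mul sqr_l2norm trmx_mul !mulmxA.
apply: inv_gram_bounds.
- by rewrite trmx_mul trmxK.
- by apply: mulmx1C; rewrite mulmxA; apply: mulmx1C.
- by move=> v; rewrite mulmxA -[_ *m v^T]mulmxA -trmx_mul -sqr_l2norm sqr_ge0.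
Qed.

(** The two range inclusions give [A = Q T] and [Q = A U], so [T U = Q^T Q = 1]. The matrix [U Q^T]
    satisfies the four Penrose equations, and uniqueness identifies it with [mpinv A]. *)
Lemma orthonormal_basis_factor (m n : nat) (A Q : 'M[R]_(m, n)) :
  orthonormal_basis_of_range A Q ->
  exists T U : 'M[R]_n, [/\ A = Q *m T, T *m U = 1%:M & mpinv A = U *m Q^T].
Proof.
move=> [QQ /andP[/submxP[D1 QD] /submxP[D2 AD]]].
have QE : Q = A *m D1^T by rewrite -[LHS]trmxK QD trmx_mul trmxK.
have AE : A = Q *m D2^T by rewrite -[LHS]trmxK AD trmx_mul trmxK.
have TU : D2^T *m D1^T = 1%:M.
  by rewrite -QQ {2}QE AE !mulmxA QQ mul1mx.
exists D2^T, D1^T; split=> //.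
have UT := mulmx1C TU; move: D1^T D2^T AE TU UT {QE QD AD} => U T AE TU UT.
apply: (@penrose_unique _ _ _ A); first exact: mpinvP.
have AX : A *m (U *m Q^T) = Q *m Q^T by rewrite AE mulmxA -(mulmxA Q) TU mulmx1.
have XA : U *m Q^T *m A = 1%:M by rewrite AE mulmxA -(mulmxA U) QQ mulmx1.
split; rewrite ?AX ?XA.
- by rewrite AE mulmxA -(mulmxA Q) QQ mulmx1.
- by rewrite mul1mx.
- by rewrite trmx_mul trmxK.
- by rewrite trmx1.
Qed.

(** In [v = v (1 + X D) - v X D] the last term has norm at most [|v| / 2], which is absorbed on the
    left. The bound yields both the invertibility of [1 + X D] and the norm bound 2 for its
    inverse. *)
Lemma l2norm_mul_1D (n m : nat) (X : 'M[R]_(n, m)) (D : 'M[R]_(m, n)) (v : 'rV[R]_n) :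
  specnorm D * specnorm X <= 1 / 2 ->
  l2norm v <= 2 * l2norm (v *m (1%:M + X *m D)).
Proof.
move=> h; have : l2norm v <= l2norm (v *m (1%:M + X *m D)) + l2norm (v *m X *m D).
  have {1}-> : v = v *m (1%:M + X *m D) + - (v *m X *m D).
    by rewrite mulmxDr mulmx1 mulmxA addrK.
  by apply: (le_trans (l2normD _ _)); rewrite l2normN.
have := l2norm_mulmxr D (v *m X); have := l2norm_mulmxr X v.
have := specnorm_ge0 D; have := l2norm_ge0 v.
move: (specnorm D) (specnorm X) h => d x h v0 d0 h1 h2 h3.
have := ler_wpM2l d0 h1; have := ler_wpM2r v0 h; lra.
Qed.

Lemma unitmx_1D (n m : nat) (X : 'M[R]_(n, m)) (D : 'M[R]_(m, n)) :
  specnorm D * specnorm X <= 1 / 2 -> 1%:M + X *m D \in unitmx.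
Proof.
move=> h; rewrite -row_free_unit -kermx_eq0; apply/rowV0P => v /sub_kermxP v0.
apply: l2norm_eq0; apply/eqP; rewrite eq_le l2norm_ge0 andbT.
by apply: (le_trans (l2norm_mul_1D _ h)); rewrite v0 l2norm0 mulr0.
Qed.

Lemma perturbation_graph (m n : nat) (A dA Q Qt : 'M[R]_(m, n)) (Rt : 'M[R]_n) :
  specnorm dA * specnorm (mpinv A) <= 1 / 2 ->
  orthonormal_basis_of_range A Q -> thin_qr (A + dA) Qt Rt ->
  exists (F : 'M[R]_(m, n)) (S : 'M[R]_n),
    [/\ Q^T *m F = 0, Qt = (Q + F) *m S
      & forall i, l2norm (row i F)
          <= 2 * specnorm (mpinv A) * l2norm (row i (perp_part A dA))].
Proof.
move=> h hQ [BE QtQt _ Rtu]; have [QQ _] := hQ.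
have [T [U [AE TU XE]]] := orthonormal_basis_factor hQ.
have UT := mulmx1C TU.
set X := mpinv A in h XE *; have Mu := unitmx_1D h.
set M := 1%:M + X *m dA in Mu.
have AX : A *m X = Q *m Q^T by rewrite AE XE mulmxA -(mulmxA Q) TU mulmx1.
(* Since [U = T^-1], the splitting reads [A + dA = (Q + F) T M]; right multiplication by [Rt^-1]
   turns [A + dA] into [Qt]. *)
exists (perp_part A dA *m invmx M *m U), (T *m M *m invmx Rt); split.
- rewrite /perp_part -/X AX !mulmxA mulmxBr mulmx1 mulmxA QQ mul1mx subrr.
  by rewrite !mul0mx.
- have -> : Qt = (A + dA) *m invmx Rt by rewrite BE mulmxK.
  rewrite !mulmxA; congr (_ *m _); rewrite !mulmxDl -(mulmxA _ U) UT mulmx1.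
  rewrite mulmxKV // -AE /perp_part -/X /M mulmxDr mulmx1 mulmxBl mul1mx !mulmxA.
  by rewrite -addrA; congr (_ + _); rewrite addrC subrK.
- move=> i; rewrite row_mul [row i (_ *m invmx M)]row_mul.
  set p := row i _; have := l2norm_mul_1D (p *m invmx M) h.
  rewrite -/M mulmxKV // => h1.
  (* Appending [Q^T] preserves the norm and completes [U] to [U Q^T = X], so the norm of the
     pseudoinverse itself controls the row. *)
  rewrite -(l2norm_mul_isometry _ QQ) -mulmxA -XE.
  apply: (le_trans (l2norm_mulmxr _ _)).
  by rewrite (mulrC 2) -mulrA ler_wpM2l ?specnorm_ge0.
Qed.

(** Scalar core of the estimate: [q], [f], [w] stand for the norms of the [j]-th rows of [Q], [F],
    [Q + F], [c] for the inner product of the first two rows, [a] for a bound on the Frobenius norm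
    of [F], [z] for the norm of the row of [Q + F] times [F^T], and [l] for the perturbed score. The
    error beyond [2 c] lies between [- z^2] and [f^2], and [w^2 <= 2 (q^2 + 1)] because [f <= 1]. *)
Lemma quadratic_perturbation_bound (q f a w z c l : R) :
  0 <= f -> f <= a -> a <= 1 -> 0 <= z -> z <= a * w ->
  w ^+ 2 = q ^+ 2 + 2 * c + f ^+ 2 -> `|c| <= q * f ->
  w ^+ 2 - z ^+ 2 <= l <= w ^+ 2 ->
  `|l - q ^+ 2| <= 2 * (q * f) + 2 * a ^+ 2 * (q ^+ 2 + 1).
Proof.
move=> f0 fa a1 z0 zaw wE; rewrite !ler_norml => /andP[c1 c2] /andP[l1 l2].
have a0 : 0 <= a := le_trans f0 fa.
have fa2 : f ^+ 2 <= a ^+ 2 by rewrite ler_sqr.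
have a21 : a ^+ 2 <= 1 by rewrite exprn_ile1.
have z2 : z ^+ 2 <= a ^+ 2 * w ^+ 2.
  by rewrite -exprMn ler_sqr // nnegrE (le_trans z0 zaw).
have w2 : w ^+ 2 <= 2 * (q ^+ 2 + 1).
  by have := sqr_ge0 (q - f); rewrite sqrrB; lra.
have aw := ler_wpM2l (sqr_ge0 a) w2.
have aq := mulr_ge0 (sqr_ge0 a) (sqr_ge0 q).
have f2 := sqr_ge0 f.
by apply/andP; split; lra.
Qed.

End Perturbation.

(** * Relative error of the leverage scores *)

Theorem theorem3p3 (R : realType) (m n : nat) (A : 'M[R]_(m, n))
    (hA : \rank A = n) :
  exists C delta : R, 0 < delta /\
    forall dA Q Qt : 'M[R]_(m, n), forall Rt : 'M[R]_n,
      specnorm dA * specnorm (mpinv A) <= 1 / 2 ->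
      orthonormal_basis_of_range A Q ->
      thin_qr (A + dA) Qt Rt ->
      epsF A dA < delta ->
      forall j : 'I_m, 0 < leverage Q j ->
        `|leverage Qt j - leverage Q j| / leverage Q j
          <= 4 * (epsj A dA j
                  + Num.sqrt 2 * Num.sqrt (stable_rank A) * epsF A dA)
               * cond2 A
             + C * epsF A dA ^+ 2.
Proof.
pose K := 2 * specnorm (mpinv A) * frobnorm A.
have K0 : 0 <= K by rewrite !mulr_ge0 ?specnorm_ge0 ?frobnorm_ge0.
(* The leverage scores of [A] are the diagonal entries of [A *m mpinv A]; vanishing
   ones contribute [0] since [0^-1 = 0]. *)
pose L := \sum_i `|(A *m mpinv A) i i|^-1.
(* [K] is chosen so that [|F|_F <= K epsF], and [delta] so that [K epsF <= 1]; the added 1 covers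
   [K = 0]. The quadratic remainder divided by the score is [2 (K epsF)^2 (1 + 1 / l_j)], and [L]
   bounds [1 / l_j] for every [j] at once, which gives [C]. *)
exists (2 * K ^+ 2 + 2 * K ^+ 2 * L), (K + 1)^-1; split.
  by rewrite invr_gt0 ltr_wpDl.
move=> dA Q Qt Rt h hQ hB heps j lj.
have [F [S [QF QtE Frow]]] := perturbation_graph h hQ hB.
have [_ QtQt _ _] := hB; have [QQ _] := hQ.
have [T [U [AE TU XE]]] := orthonormal_basis_factor hQ.
have AX : A *m mpinv A = Q *m Q^T by rewrite XE AE mulmxA -(mulmxA Q) TU mulmx1.
have lE : leverage Q j = (A *m mpinv A) j j.
  rewrite AX /leverage sqr_l2norm mul_tr_entry mxE.
  by apply: eq_bigr => k _; rewrite !mxE.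
have lL : (leverage Q j)^-1 <= L.
  rewrite -[leverage Q j]ger0_norm ?(ltW lj) // lE /L (bigD1 j) //=.
  by rewrite lerDl sumr_ge0 // => i _; rewrite invr_ge0.
have hfF := l2norm_row_le_frobnorm F j.
(* As [Q Q^T] fixes [A], row [j] of [A] is row [j] of [Q] times [Q^T A]. This trades [1 / |q|] for
   [|A| / |e_j A|] in the first-order term. *)
have qA : l2norm (row j A) <= specnorm A * l2norm (row j Q).
  rewrite -(l2norm_mul_isometry (row j Q) QQ).
  have -> : row j A = row j Q *m Q^T *m A.
    by rewrite -!row_mul -AX; have [-> _ _ _] := mpinvP A.
  exact: l2norm_mulmxr.
(* A positive score makes row [j] of [A] nonzero, so the denominators of [epsj] and [epsF] are
   genuine. *)
have Ap : 0 < l2norm (row j A).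
  rewrite lt_neqAle l2norm_ge0 andbT eq_sym; apply/eqP => /l2norm_eq0 A0.
  move: lj; have -> : Q = A *m U by rewrite AE -mulmxA TU mulmx1.
  by rewrite /leverage row_mul A0 mul0mx l2norm0 expr0n ltxx.
have frA : 0 < frobnorm A := lt_le_trans Ap (l2norm_row_le_frobnorm A j).
have X2 : 0 <= 2 * specnorm (mpinv A) by rewrite mulr_ge0 ?specnorm_ge0.
have e0 : 0 <= epsF A dA by rewrite divr_ge0 ?frobnorm_ge0.
have FK : frobnorm F <= K * epsF A dA.
  apply: (le_trans (frobnorm_le_rows X2 Frow)).
  rewrite /K /epsF -!mulrA ler_wpM2l // ler_wpM2l ?specnorm_ge0 //.
  by rewrite mulrCA mulfV ?mulr1 // gt_eqF.
have Ke1 : K * epsF A dA <= 1.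
  have := ler_wpM2l K0 (ltW heps); move/le_trans; apply.
  by rewrite ler_pdivrMr ?mul1r ?lerDl // ltr_wpDl.
have num : `|leverage Qt j - leverage Q j|
    <= 2 * (l2norm (row j Q) * l2norm (row j F))
       + 2 * (K * epsF A dA) ^+ 2 * (leverage Q j + 1).
  apply: (@quadratic_perturbation_bound _ _ _ _ (l2norm (row j (Q + F)))
    (l2norm (row j (Q + F) *m F^T)) ((row j Q *m (row j F)^T) 0 0)).
  - exact: l2norm_ge0.
  - exact: le_trans hfF FK.
  - exact: Ke1.
  - exact: l2norm_ge0.
  - apply: (le_trans (l2norm_mul_frobnorm _ _)).
    by rewrite ler_wpM2r ?l2norm_ge0.
  - by rewrite -sqr_l2normD -linearD.
  - exact: cauchy_schwarz.
  - exact: leverage_graph_bounds QQ QF QtE QtQt.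
have q0 : 0 < l2norm (row j Q).
  rewrite lt_neqAle l2norm_ge0 andbT eq_sym; apply/eqP => q0.
  by move: lj; rewrite /leverage q0 expr0n ltxx.
have first_order : 2 * (l2norm (row j Q) * l2norm (row j F)) / leverage Q j
    <= 4 * epsj A dA j * cond2 A.
  have -> : 2 * (l2norm (row j Q) * l2norm (row j F)) / leverage Q j
      = 2 * (l2norm (row j F) / l2norm (row j Q)).
    by rewrite /leverage; field; rewrite gt_eqF.
  have -> : 4 * epsj A dA j * cond2 A
      = 2 * (2 * specnorm (mpinv A) * l2norm (row j (perp_part A dA))
             * specnorm A / l2norm (row j A)).
    by rewrite /epsj /cond2; field; rewrite gt_eqF.
  rewrite ler_wpM2l // ler_pdivrMr // mulrAC ler_pdivlMr // -[leRHS]mulrA.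
  by apply: ler_pM; rewrite ?l2norm_ge0.
(* Nonnegativity allows this summand to be added to the right-hand side of [first_order]. *)
have sr0 : 0 <= 4 * (Num.sqrt 2 * Num.sqrt (stable_rank A) * epsF A dA) * cond2 A.
  by rewrite !mulr_ge0 ?sqrtr_ge0 ?specnorm_ge0 ?invr_ge0 ?frobnorm_ge0.
have second_order : 2 * (K * epsF A dA) ^+ 2 * (leverage Q j + 1) / leverage Q j
    <= (2 * K ^+ 2 + 2 * K ^+ 2 * L) * epsF A dA ^+ 2.
  rewrite -[leLHS]mulrA [X in _ * X <= _]mulrDl mulfV ?gt_eqF // mul1r.
  have -> : (2 * K ^+ 2 + 2 * K ^+ 2 * L) * epsF A dA ^+ 2
      = 2 * (K * epsF A dA) ^+ 2 * (1 + L) by ring.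
  by rewrite ler_wpM2l ?lerD2l // mulr_ge0 ?sqr_ge0.
have : `|leverage Qt j - leverage Q j| / leverage Q j
    <= (2 * (l2norm (row j Q) * l2norm (row j F))
       + 2 * (K * epsF A dA) ^+ 2 * (leverage Q j + 1)) / leverage Q j.
  by rewrite ler_pM2r ?invr_gt0.
rewrite mulrDl => /le_trans; apply.
rewrite mulrDr mulrDl; lra.
Qed.
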